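(* Assume the following (a conjecture): for all real $c,\beta$ with $\sqrt{\beta}\geq c^{-1}>1$, the limit $\lim_{\theta\to 0}\tilde{\rho}(\mathcal{M}(\theta,c,\beta))$ exists and $$\lim_{\theta\to 0}\tilde{\rho}(\mathcal{M}(\theta,c,\beta))=c^{1/(\bar{d}^{(bdd)}(\beta)+1)}.$$ Then for all $\beta\in(1,\infty)$, $$\bar{d}^{(bdd)}(\beta)\geq F^{-1}(\beta),$$ where $F(x)=\frac{(x+1)^{x+1}}{x^x}$ for $x\in\mathbb{R}_{\geq 0}$ (with $0^0=1$), a strictly increasing function mapping $[0,\infty)$ onto $[1,\infty)$, and $F^{-1}$ is its inverse.
   Context: Minimal average digit. Let $\beta\in\mathbb{R}_{>1}$ and $J\in\mathbb{Z}\cup\{-\infty\}$. Let $\mathcal{B}_J$ be the set of bounded sequences $\{d_j\}_{j\ge J}$ (indexed by integers $j\geq J$, or by all integers if $J=-\infty$) with $d_j\in\mathbb{Z}_{\geq 0}$ and, if $J=-\infty$, with only finitely many nonzero $d_j$ for negative $j$. The bound on the sequence is not specified a priori. Define $$\bar{d}^{(bdd)}_J(\beta,u)=\inf_{\{d_j\}\in\mathcal{B}_J}\Big\{\limsup_{k\to\infty}\frac1k\sum_{j=J}^{k}d_j \;:\; u=\sum_{j=J}^\infty\frac{d_j}{\beta^j}\Big\},\qquad \bar{d}^{(bdd)}(\beta)=\sup_{u\in\mathbb{R}_{>0}}\bar{d}^{(bdd)}_J(\beta,u);$$ the value $\bar{d}^{(bdd)}(\beta)$ does not depend on the choice of $J$.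 Stabilisability radius. For a set of matrices $\mathcal{M}=\{A_\sigma\}_{\sigma\in\Sigma}\subset\mathbb{R}^{n\times n}$, consider the discrete time switched linear system $x(k+1)=A_{\sigma_k}x(k)$, $x(0)=x$, with switching signal $\{\sigma_k\}_{k\ge 0}$ in $\Sigma$. Define $$\tilde{\rho}_x(\mathcal{M})=\inf\{\lambda\geq 0 \;|\; \exists M>0,\ \{\sigma_k\}\text{ such that }\|x(k)\|\leq M\lambda^k\|x\|\ \ \forall k\in\mathbb{Z}_{\geq 0}\},$$ $$\tilde{\rho}(\mathcal{M})=\sup_{x\in\mathbb{R}^n\setminus\{0\}}\tilde{\rho}_x(\mathcal{M}).$$ The matrix set. $\mathcal{M}(\theta,c,\beta)=\{A_1,A_2\}$ with $$A_1=\begin{pmatrix}\cos\theta&\sin\theta\\-\sin\theta&\cos\theta\end{pmatrix},\qquad A_2=\begin{pmatrix}c&0\\0&\beta c\end{pmatrix}.$$ *)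

(* Defs.v *)
From HB Require Import structures.
From mathcomp Require Import all_boot all_order all_algebra.
From mathcomp Require Import all_classical all_reals all_analysis.

Set Implicit Arguments.
Unset Strict Implicit.
Unset Printing Implicit Defensive.

Import Order.TTheory GRing.Theory Num.Theory.
Import numFieldNormedType.Exports.

Local Open Scope classical_set_scope.
Local Open Scope ring_scope.

(* [Some m] stands for the starting index J = m, [None] for J = -oo. *)
Definition indices (J : option int) : set int :=
  [set j | if J is Some m then m <= j else True].

(* Digits are indexed by all of int; the values outside [indices J] are never
   looked at. *)
Definition bounded_digits (J : option int) (d : int -> nat) : Prop :=
  (exists B : nat, forall j, indices J j -> (d j <= B)%N) /\
  (J = None -> finite_set [set j | j < 0 /\ d j <> 0%N]).

(* All terms being nonnegative, the unordered sum in \bar R is the sum of the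
   series. *)
Definition represents (R : realType) (J : option int) (beta : R)
    (d : int -> nat) (u : R) : Prop :=
  u%:E = \esum_(j in indices J) ((d j)%:R / beta ^ j)%:E.

(* The inner sum is over a set which is infinite when J = -oo; it only takes
   into account the indices with nonzero terms, of which there are finitely
   many when [bounded_digits J d] holds. *)
Definition avg_digit (R : realType) (J : option int) (d : int -> nat) : \bar R :=
  limn_esup (fun k : nat =>
    (k%:R^-1 * \sum_(j \in indices J `&` [set j | j <= k%:Z]) ((d j)%:R : R))%:E).

Definition dbar_at (R : realType) (J : option int) (beta u : R) : \bar R :=
  ereal_inf [set avg_digit R J d | d in
    [set d | bounded_digits J d /\ represents J beta d u]].

Definition dbar (R : realType) (J : option int) (beta : R) : \bar R :=
  ereal_sup [set dbar_at J beta u | u in [set u : R | 0 < u]].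

Fixpoint trajectory (R : realType) (n : nat) (A : nat -> 'M[R]_n) (x : 'cV[R]_n)
    (k : nat) : 'cV[R]_n :=
  if k is k'.+1 then A k' *m trajectory A x k' else x.

(* A switching signal is given by the matrices it selects. The norm `|_| on
   'cV[R]_n is the max norm; because of the constant M, any other norm on R^n
   gives the same value. *)
Definition stab_radius_at (R : realType) (n : nat) (Ms : set 'M[R]_n)
    (x : 'cV[R]_n) : \bar R :=
  ereal_inf [set lambda%:E | lambda in
    [set lambda : R | 0 <= lambda /\
      exists M : R, 0 < M /\ exists A : nat -> 'M[R]_n,
        (forall k, Ms (A k)) /\
        (forall k, `|trajectory A x k| <= M * lambda ^+ k * `|x|)]].

Definition stab_radius (R : realType) (n : nat) (Ms : set 'M[R]_n) : \bar R :=
  ereal_sup [set stab_radius_at Ms x | x in [set x : 'cV[R]_n | x <> 0]].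

Definition mx2 (R : realType) (a b c d : R) : 'M[R]_2 :=
  \matrix_(i, j) if i == 0 then (if j == 0 then a else b)
                 else (if j == 0 then c else d).

Definition matrix_pair (R : realType) (theta c beta : R) : set 'M[R]_2 :=
  [set mx2 (cos theta) (sin theta) (- sin theta) (cos theta);
       mx2 c 0 0 (beta * c)].

(* 0 `^ 0 = 1. *)
Definition F (R : realType) (x : R) : R := (x + 1) `^ (x + 1) / x `^ x.

(* The inverse of F : [0, +oo[ -> [1, +oo[, extended by 0 elsewhere. *)
Definition Finv (R : realType) : R -> R := 'pinv_(fun=> 0) `[0, +oo[ (@F R).

(* Main.v *)
Require Import Defs.
From HB Require Import structures.
From mathcomp Require Import all_boot all_order all_algebra.
From mathcomp Require Import all_classical all_reals all_analysis.
From mathcomp Require Import lra ring.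

(* A word of length [n] in the two matrices with [k] occurrences of the second
   one has determinant [(beta * c ^+ 2) ^+ k], so among the points [(1, t)] with
   [0 <= t <= 1] those mapped to norm at most [eps] fill a set of measure
   [O(eps ^+ 2 / (beta * c ^+ 2) ^+ k)]; it is empty unless
   [c ^+ k <= sqrt 2 * eps], so one may multiply this bound by the factor
   [(2 * eps ^+ 2 / c ^+ (2 * k)) ^+ a] for any [a].  Summing over all words with
   [eps = M * lambda ^+ n] gives
   [O((lambda ^+ (2 * a.+1) * (1 + 1 / (beta * c ^+ (2 * a.+1)))) ^+ n)].  If the
   base is less than 1, then for each [M] almost no point admits a trajectory
   bounded by [M * lambda ^+ n], hence [lambda] is a lower bound of the
   stabilisability radius, uniformly in [theta].  With
   [c ^+ (2 * a.+1) = Finv beta / beta] this gives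
   [c `^ (Finv beta + 1)^-1 <= stab_radius], and the conjectured value of the
   limit turns this into [Finv beta <= dbar]. *)

Set Implicit Arguments.
Unset Strict Implicit.
Unset Printing Implicit Defensive.

Import Order.TTheory GRing.Theory Num.Theory.
Import numFieldNormedType.Exports.

Local Open Scope classical_set_scope.
Local Open Scope ring_scope.

(** * The function [F]: monotonicity, range and inverse *)

Lemma F_expR (R : realType) (x : R) : 0 <= x ->
  F x = expR ((x + 1) * ln (x + 1) - x * ln x).
Proof.
move=> x0; rewrite /F /powR (gt_eqF (_ : 0 < x + 1)) ?ltr_wpDl//.
have [->|_] := eqVneq x 0; last by rewrite expRB.
by rewrite divr1 mul0r subr0.
Qed.

Lemma ln_le_subr1 (R : realType) (z : R) : 0 < z -> ln z <= z - 1.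
Proof. by move=> z0; rewrite -{1}(subrK 1 z) addrC le_ln1Dx//; lra. Qed.

(* [F x] is the infimum over [s > 0] of [(1 + s) `^ (x + 1) / s], attained at
   [s = 1 / x] when [0 < x]. *)
Lemma F_le (R : realType) (x s : R) : 0 <= x -> 0 < s ->
  F x <= expR ((x + 1) * ln (1 + s) - ln s).
Proof.
move=> x0 s0; rewrite F_expR// ler_expR.
have p0 : 0 < 1 + s by lra.
have x1 : 0 < x + 1 by lra.
(* The claim is [ln z1 + x * ln z2 <= 0] for [z1 = s * (x + 1) / (1 + s)] and
   [z2 = (x + 1) / (x * (1 + s))]; the bounds [ln z <= z - 1], weighted by 1 and [x], add up to
   0. *)
have := @ln_le_subr1 R (s * (x + 1) / (1 + s)).
rewrite !ln_div ?lnM ?posrE ?divr_gt0 ?mulr_gt0// => /(_ isT) h1.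
have [->|xn0] := eqVneq x 0.
  rewrite add0r ln1 mul0r mulr0 subr0 mul1r subr_ge0 ler_ln ?posrE//; lra.
have xp : 0 < x by rewrite lt_neqAle eq_sym xn0.
have := @ln_le_subr1 R ((x + 1) / (x * (1 + s))).
rewrite !ln_div ?lnM ?posrE ?divr_gt0 ?mulr_gt0// => /(_ isT).
rewrite -(ler_pM2l xp) => h2.
have e : s * (x + 1) / (1 + s) - 1 + x * ((x + 1) / (x * (1 + s)) - 1) = 0.
  by field; rewrite xn0 gt_eqF.
lra.
Qed.

Lemma F_inv (R : realType) (x : R) : 0 < x ->
  F x = expR ((x + 1) * ln (1 + x^-1) - ln x^-1).
Proof.
move=> x0; rewrite F_expR ?ltW//; congr expR.
have -> : 1 + x^-1 = (x + 1) / x by field; rewrite gt_eqF.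
rewrite ln_div ?lnV ?posrE//; [ring | lra].
Qed.

(** At [s = 1 / y] the bound of [F_le] is an equality for [y], and its exponent increases strictly
    with the argument because [0 < ln (1 + s)]. *)
Lemma F_lt (R : realType) : {in `[0, +oo[ &, {homo @F R : x y / x < y}}.
Proof.
move=> x y; rewrite !in_itv/= !andbT => x0 _ xy.
have y0 : 0 < y by lra.
have s0 : 0 < y^-1 by rewrite invr_gt0.
rewrite (F_inv y0) (le_lt_trans (F_le x0 s0))// ltr_expR ltrD2r.
by rewrite ltr_pM2r ?ln_gt0// ?ltrD2r// ltrDl.
Qed.

Lemma F0 (R : realType) : F 0 = 1 :> R.
Proof. by rewrite F_expR// add0r ln1 mulr0 mul0r subr0 expR0. Qed.

Lemma add1_le_F (R : realType) (x : R) : 0 <= x -> x + 1 <= F x.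
Proof.
move=> x0; rewrite F_expR// -[leLHS]lnK ?posrE; last by lra.
rewrite ler_expR mulrDl mul1r.
have [->|xn0] := eqVneq x 0; first by rewrite !mul0r; lra.
have xp : 0 < x by rewrite lt_neqAle eq_sym xn0.
suff : x * ln x <= x * ln (x + 1) by lra.
by rewrite ler_pM2l// ler_ln ?posrE//; lra.
Qed.

Lemma F_image (R : realType) : @F R @` `[0, +oo[%classic = `[1, +oo[%classic.
Proof.
apply/seteqP; split => [_ [x /= + <-]|y /=].
  rewrite !in_itv/= !andbT => x0; have := add1_le_F x0; lra.
rewrite !in_itv/= !andbT le_eqVlt => /orP[/eqP <-|y1].
  by exists 0; [rewrite /= in_itv/= lexx | rewrite F0].
(* To apply the IVT away from 0, a positive [a] with [F a <= y] is needed. With this [s] the bound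
   of [F_le] at 0 is [(y + 1) / 2 < y], and [a] is the point where that bound reaches [y]. *)
pose s := 2 / (y - 1).
have s0 : 0 < s by rewrite divr_gt0//; lra.
have e1 : (1 + s) / s = (y + 1) / 2 by rewrite /s; field; rewrite gt_eqF//; lra.
have l0 : 0 < ln (1 + s) by rewrite ln_gt0//; lra.
have q1 : (1 + s) / s < y by rewrite e1; lra.
pose a := ln (y / ((1 + s) / s)) / ln (1 + s).
have p0 : 0 < (1 + s) / s by rewrite divr_gt0//; lra.
have a0 : 0 < a by rewrite divr_gt0// ln_gt0// ltr_pdivlMr// mul1r.
have Fa : F a <= y.
  apply: le_trans (F_le (ltW a0) s0) _.
  rewrite mulrDl mul1r divfK ?gt_eqF// !ln_div ?posrE//; try lra.
  by rewrite -[leRHS]lnK ?posrE//; [rewrite ler_expR|]; lra.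
have Fb : y <= F y by have := @add1_le_F R y; lra.
have aby : a <= y.
  rewrite leNgt; apply/negP => ya; have y0 : 0 <= y by lra.
  have := @F_lt R y a; rewrite !in_itv/= !andbT => /(_ y0 (ltW a0) ya); lra.
have hc : {within `[a, y],
    continuous (fun x : R => (x + 1) * ln (x + 1) - x * ln x)}.
  apply: continuous_in_subspaceT => x; rewrite inE/= in_itv/= => /andP[ax _].
  have x0 : 0 < x by lra.
  have x1 : 0 < x + 1 by lra.
  have c1 : {for x, continuous (fun z : R => z + 1)}.
    by apply: cvgD => //; exact: cvg_cst.
  have cl : {for x, continuous (fun z : R => ln (z + 1))}.
    by apply: (continuous_comp c1); exact: continuous_ln.
  by apply: cvgB; apply: cvgM => //; exact: continuous_ln.
have [|x + hx] := @IVT R _ a y (ln y) aby hc.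
  rewrite ge_min le_max -[X in _ && (_ || X)]ler_expR -[X in (X || _) && _]ler_expR.
  rewrite !lnK ?posrE; try lra.
  by rewrite -!F_expR ?Fa ?Fb ?orbT//; lra.
rewrite in_itv/= => /andP[ax xy]; exists x.
  by rewrite /= in_itv/= andbT; lra.
by rewrite F_expR; [rewrite hx lnK// posrE|]; lra.
Qed.

Lemma FinvK (R : realType) (y : R) : 1 < y -> F (Finv y) = y.
Proof.
move=> y1; apply: pinvK; rewrite F_image inE/= in_itv/= andbT; exact: ltW.
Qed.

Lemma Finv_gt0 (R : realType) (y : R) : 1 < y -> 0 < Finv y.
Proof.
move=> y1; have yF : y \in @F R @` `[0, +oo[%classic.
  by rewrite F_image inE/= in_itv/= andbT; exact: ltW.
have : 0 <= Finv y.
  have : `[0, +oo[%classic (Finv y).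
    apply: (@surjpinv_image_sub _ _ _ _ _ (@F R)); first exact: subset_refl.
    by exists y; [exact/set_mem|].
  by rewrite /= in_itv/= andbT.
rewrite le_eqVlt => /orP[/eqP e|//]; have := FinvK y1.
by rewrite -e F0; lra.
Qed.

(** * Words in the two matrices and the measure of points with short images *)

Lemma measure_bigsetU_le d (T : ringOfSetsType d) (R : realFieldType)
    (mu : {measure set T -> \bar R}) (K : Type) (s : seq K) (I : K -> set T)
    (g : K -> R) :
  (forall w, measurable (I w)) -> (forall w, (mu (I w) <= (g w)%:E)%E) ->
  (mu (\big[setU/set0]_(w <- s) I w) <= (\sum_(w <- s) g w)%:E)%E.
Proof.
move=> mI gI; elim: s => [|w s IH]; first by rewrite !big_nil measure0.
have mU : measurable (\big[setU/set0]_(v <- s) I v) by exact: bigsetU_measurable.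
rewrite !big_cons EFinD; apply: le_trans (leeD (gI w) IH).
exact: measureU2.
Qed.

Section Words.
Variables (R : realType) (theta c beta : R).

Definition letter (b : bool) : 'M[R]_2 :=
  if b then mx2 c 0 0 (beta * c)
  else mx2 (cos theta) (sin theta) (- sin theta) (cos theta).

(** The head of the word acts last, so one more step of a trajectory is a cons. *)
Definition word_mx (w : seq bool) : 'M[R]_2 :=
  foldr (fun b B => letter b *m B) 1%:M w.

Fixpoint words (n : nat) : seq (seq bool) :=
  if n is n'.+1 then
    [seq false :: w | w <- words n'] ++ [seq true :: w | w <- words n']
  else [:: [::]].

Lemma mem_words (w : seq bool) : w \in words (size w).
Proof.
elim: w => [|[] w IH] //=; rewrite mem_cat; apply/orP; [right|left];
  by rewrite mem_map// => ? ? [].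
Qed.

Lemma sum_words (q : R) (n : nat) :
  \sum_(w <- words n) q ^+ count id w = (1 + q) ^+ n.
Proof.
elim: n => [|n IH] /=; first by rewrite big_seq1.
rewrite big_cat !big_map /= exprS mulrDl mul1r -IH mulr_sumr; congr (_ + _).
by apply: eq_bigr => w _; rewrite add1n exprS.
Qed.

Lemma mx2E0 (x y z t : R) (v : 'cV[R]_2) :
  (mx2 x y z t *m v) ord0 ord0 = x * v ord0 ord0 + y * v ord_max ord0.
Proof.
have e1 : lift ord0 ord0 = ord_max :> 'I_2 by apply/val_inj.
by rewrite !mxE !big_ord_recl big_ord0 addr0 !mxE/= e1.
Qed.

Lemma mx2E1 (x y z t : R) (v : 'cV[R]_2) :
  (mx2 x y z t *m v) ord_max ord0 = z * v ord0 ord0 + t * v ord_max ord0.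
Proof.
have e1 : lift ord0 ord0 = ord_max :> 'I_2 by apply/val_inj.
by rewrite !mxE !big_ord_recl big_ord0 addr0 !mxE/= e1.
Qed.

(** The determinant with columns [u] and [v], a signed area. *)
Definition cross (u v : 'cV[R]_2) : R :=
  u ord0 ord0 * v ord_max ord0 - u ord_max ord0 * v ord0 ord0.

(** The Euclidean norm squared: unlike the max norm, it is invariant under rotations. *)
Definition sqnorm (v : 'cV[R]_2) : R := v ord0 ord0 ^+ 2 + v ord_max ord0 ^+ 2.

Lemma cross_word (w : seq bool) (u v : 'cV[R]_2) :
  cross (word_mx w *m u) (word_mx w *m v) =
  (beta * c ^+ 2) ^+ count id w * cross u v.
Proof.
elim: w => [|b w IH] /=; first by rewrite !mul1mx mul1r.
rewrite -!mulmxA; move: IH; set u' := _ *m u; set v' := _ *m v => IH.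
rewrite exprD -mulrA -IH /cross.
case: b => /=; rewrite !(mx2E0, mx2E1) ?expr1 ?expr0; first by ring.
transitivity ((cos theta ^+ 2 + sin theta ^+ 2) *
  (u' ord0 ord0 * v' ord_max ord0 - u' ord_max ord0 * v' ord0 ord0)).
  by ring.
by rewrite cos2Dsin2.
Qed.

Hypotheses (c0 : 0 < c) (beta1 : 1 <= beta).

Let beta0 : 0 < beta. Proof. exact: lt_le_trans beta1. Qed.

(** Rotations are isometries, and the diagonal matrix shrinks lengths by at most [c] since
    [1 <= beta]. *)
Lemma sqnorm_word (w : seq bool) (v : 'cV[R]_2) :
  c ^+ (2 * count id w) * sqnorm v <= sqnorm (word_mx w *m v).
Proof.
elim: w => [|b w IH] /=; first by rewrite !mul1mx mul1r.
rewrite -!mulmxA; move: IH; set v' := word_mx w *m v => IH.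
rewrite mulnDr exprD -mulrA.
apply: (le_trans (ler_wpM2l _ IH)); first by rewrite exprn_ge0// ltW.
rewrite /sqnorm; case: b => /=; rewrite !(mx2E0, mx2E1).
  rewrite !mul0r addr0 add0r !exprMn mulrDr lerD2l.
  rewrite ler_wpM2r ?sqr_ge0// ler_peMl ?sqr_ge0//.
  by rewrite exprn_ege1.
rewrite muln0 expr0 mul1r le_eqVlt; apply/orP; left; apply/eqP.
transitivity ((cos theta ^+ 2 + sin theta ^+ 2) *
  (v' ord0 ord0 ^+ 2 + v' ord_max ord0 ^+ 2)); last by ring.
by rewrite cos2Dsin2 mul1r.
Qed.

Lemma trajectory_word (A : nat -> 'M[R]_2) :
  (forall k, matrix_pair theta c beta (A k)) ->
  forall n, exists2 w, size w = n & forall x, trajectory A x n = word_mx w *m x.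
Proof.
move=> hA; elim=> [|n [w sw hw]]; first by exists [::] => // x; rewrite /= mul1mx.
have [b hb] : exists b, A n = letter b.
  by have [->|->] := hA n; [exists false|exists true].
by exists (b :: w) => [/=|x /=]; rewrite ?sw// hb hw mulmxA.
Qed.


Lemma le_coord_norm (v : 'cV[R]_2) (i : 'I_2) : `|v i ord0| <= `|v|.
Proof.
rewrite [leRHS]/Num.Def.normr/= mx_normrE; apply/bigmax_geP; right => /=.
by exists (i, ord0).
Qed.

(** A segment of directions, parametrised so that Lebesgue measure on the line applies. *)
Definition affine_point (t : R) : 'cV[R]_2 := \col_i (if i == 0 then 1 else t).

Lemma norm_affine_point (t : R) : 0 <= t <= 1 -> `|affine_point t| = 1.
Proof.
move=> /andP[t0 t1]; apply/eqP; rewrite eq_le; apply/andP; split.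
  rewrite [leLHS]/Num.Def.normr/= mx_normrE; apply/bigmax_leP; split=> //= -[i j] _ /=.
  by rewrite mxE; case: ifP => _; rewrite ?normr1 ?ger0_norm.
have := le_coord_norm (affine_point t) ord0.
by rewrite mxE/= normr1.
Qed.

(* Two parameters [t], [t'] with short images span a small area there, and this
   area is [|t - t'|] times the determinant of the word; moreover a short image
   forces the word to contain many letters [true]. *)
Lemma short_image_interval (a : nat) (w : seq bool) (eps : R) :
  0 <= eps -> exists I : set (measurableTypeR R),
    [/\ measurable I,
        (lebesgue_measure I <= (2 ^+ a.+2 * eps ^+ (2 * a.+1) *
           (beta * c ^+ (2 * a.+1))^-1 ^+ count id w)%:E)%E &
        forall t, `|word_mx w *m affine_point t| <= eps -> I t].
Proof.
move=> e0; set k := count id w.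
have D0 : 0 < beta * c ^+ 2 by rewrite mulr_gt0 ?exprn_gt0.
have Dk0 : 0 < (beta * c ^+ 2) ^+ k by rewrite exprn_gt0.
have q0 : 0 <= (beta * c ^+ (2 * a.+1))^-1.
  by rewrite ltW// invr_gt0 mulr_gt0 ?exprn_gt0.
have [[t1 ht1]|no] := pselect (exists t, `|word_mx w *m affine_point t| <= eps);
  last first.
  exists set0; split => // [|t ht]; last by apply: no; exists t.
  rewrite measure0 lee_fin; apply: mulr_ge0; last exact: exprn_ge0.
  by apply: mulr_ge0; apply: exprn_ge0.
(* Two images with coordinates at most [eps] have cross product at most [2 * eps ^+ 2]; dividing by
   the determinant bounds the distance from [t1]. *)
pose l := 2 * eps ^+ 2 / (beta * c ^+ 2) ^+ k.
have l0 : 0 <= l by rewrite divr_ge0 ?mulr_ge0 ?exprn_ge0// ltW.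
exists `[t1 - l, t1 + l]%classic; split=> [||t ht].
- exact: measurable_itv.
  apply: (@le_trans _ _ (2 * l)%:E).
    rewrite lebesgue_measure_itv/=; case: ifP => _; last by rewrite lee_fin mulr_ge0.
    by rewrite -EFinB lee_fin; lra.
  rewrite lee_fin.
  have ck : c ^+ (2 * k) <= 2 * eps ^+ 2.
    apply: le_trans (_ : sqnorm (word_mx w *m affine_point t1) <= _).
      apply: le_trans (sqnorm_word w (affine_point t1)).
      rewrite ler_peMr ?exprn_ge0 ?(ltW c0)//.
      by rewrite /sqnorm !mxE/= expr1n lerDl sqr_ge0.
    rewrite /sqnorm mulr2n mulrDl !mul1r lerD//.
      rewrite -real_normK ?num_real// lerXn2r ?nnegrE//.
      exact: le_trans (le_coord_norm _ _) ht1.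
    rewrite -real_normK ?num_real// lerXn2r ?nnegrE//.
    exact: le_trans (le_coord_norm _ _) ht1.
  have ck0 : 0 < c ^+ (2 * k) by rewrite exprn_gt0.
  (* The required bound is the length [2 * l] times the [a]-th power of a ratio that is at least 1
     by [ck]. *)
  have -> : 2 ^+ a.+2 * eps ^+ (2 * a.+1) * (beta * c ^+ (2 * a.+1))^-1 ^+ k =
      2 * l * ((2 * eps ^+ 2) / c ^+ (2 * k)) ^+ a.
    have -> : eps ^+ (2 * a.+1) = eps ^+ 2 * (eps ^+ 2) ^+ a.
      by rewrite mulnS exprD exprM.
    have hX : (beta * c ^+ (2 * a.+1)) ^+ k =
        (beta * c ^+ 2) ^+ k * (c ^+ (2 * k)) ^+ a.
      rewrite !exprMn -mulrA -!exprM -exprD; congr (_ * _).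
      rewrite -exprD; congr (_ ^+ _).
      by rewrite addnn -mul2n mulnS mulnDl -!mulnA (mulnC a).
    have alg (x y p q z : R) : x != 0 -> y != 0 ->
        2 * (2 * z) * (p * q) / (x * y) = 2 * (2 * p / x) * (z * q / y).
      by move=> x0 y0; field; rewrite x0 y0.
    rewrite exprVn hX /l expr_div_n (exprMn _ 2) (exprS 2 a.+1) (exprS 2 a).
    by apply: alg; rewrite ?expf_neq0// gt_eqF.
  apply: ler_peMr; first exact: mulr_ge0.
  by apply: exprn_ege1; rewrite ler_pdivlMr ?mul1r.
have cr := cross_word w (affine_point t1) (affine_point t).
rewrite /= in_itv/= -ler_distlC distrC ler_pdivlMr// mulrC.
rewrite -{1}(gtr0_norm Dk0) -normrM.
have -> : t - t1 = cross (affine_point t1) (affine_point t).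
  by rewrite /cross !mxE/= mul1r mulr1.
rewrite -cr /cross (le_trans (ler_normB _ _))// !normrM mulr2n mulrDl !mul1r expr2.
by rewrite lerD// ler_pM// (le_trans (le_coord_norm _ _)).
Qed.

(** For each [n] the set is covered by the intervals of all words of length [n]; by the binomial sum
    [sum_words] their total measure is at most [C * r ^+ n], which tends to 0. *)
Lemma negligible_bounded_rate (a : nat) (lambda M : R) : 0 < lambda -> 0 < M ->
  lambda ^+ (2 * a.+1) * (1 + (beta * c ^+ (2 * a.+1))^-1) < 1 ->
  lebesgue_measure.-negligible [set t : R | exists A : nat -> 'M[R]_2,
    (forall k, matrix_pair theta c beta (A k)) /\
    (forall k, `|trajectory A (affine_point t) k| <= M * lambda ^+ k)].
Proof.
move=> l0 M0; set q := _^-1; set r := (X in X < 1) => r1.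
have q0 : 0 < q by rewrite invr_gt0 mulr_gt0 ?exprn_gt0.
have r0 : 0 < r by rewrite mulr_gt0 ?exprn_gt0 ?addr_gt0.
have eps0 n : 0 <= M * lambda ^+ n by rewrite mulr_ge0 ?exprn_ge0// ltW.
pose I n w := projT1 (cid (short_image_interval a w (eps0 n))).
have mI n w : measurable (I n w) by rewrite /I; case: cid => ? [].
have leI n w : (lebesgue_measure (I n w) <=
    (2 ^+ a.+2 * (M * lambda ^+ n) ^+ (2 * a.+1) * q ^+ count id w)%:E)%E.
  by rewrite /I; case: cid => ? [].
have subI n w t : `|word_mx w *m affine_point t| <= M * lambda ^+ n -> I n w t.
  by rewrite /I; case: cid => ? /= [_ _]; exact.
pose V n := \big[setU/set0]_(w <- words n) I n w.
have mV n : measurable (V n) by apply: bigsetU_measurable => w _; exact: mI.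
pose C := 2 ^+ a.+2 * M ^+ (2 * a.+1).
have leV n : (lebesgue_measure (V n) <= (C * r ^+ n)%:E)%E.
  apply: le_trans (measure_bigsetU_le _ (mI n) (leI n)) _.
  rewrite -mulr_sumr sum_words lee_fin le_eqVlt; apply/orP; left; apply/eqP.
  by rewrite /C /r !exprMn -!exprM (mulnC n) !mulrA.
have mX : measurable (\bigcap_n V n) by exact: bigcapT_measurable.
exists (\bigcap_n V n); split=> //.
  have le n : (lebesgue_measure (\bigcap_n V n) <= (C * r ^+ n)%:E)%E.
    apply: le_trans (leV n); rewrite le_measure ?inE//; exact: bigcap_inf.
  have : lebesgue_measure (\bigcap_n V n) \is a fin_num.
    by rewrite ge0_fin_numE// (le_lt_trans (le 0%N))// ltry.
  have m0 : (0 <= lebesgue_measure (\bigcap_n V n))%E by exact: measure_ge0.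
  move: le m0; case: (lebesgue_measure _) => // x le; rewrite lee_fin => x0 _.
  congr (_%:E); apply/eqP; rewrite eq_le x0 andbT.
  have cv : (geometric C r : R^nat) @ \oo --> 0.
    by apply: cvg_geometric; rewrite gtr0_norm.
  rewrite -(cvg_lim _ cv)//; apply: limr_ge; first by apply/cvg_ex; exists 0.
  by near=> n; have := le n; rewrite lee_fin.
move=> t [A [hA ht]] n _.
have [w sw hw] := trajectory_word hA n.
rewrite /V -bigcup_seq; exists w; last by apply: subI; rewrite -hw.
by rewrite /= -sw mem_words.
Unshelve. all: by end_near.
Qed.

End Words.

(** * A lower bound for the stabilisability radius, uniform in the angle *)

Lemma stab_radius_ge (R : realType) (theta c beta lambda : R) (a : nat) :
  0 < c -> 1 <= beta -> 0 < lambda ->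
  lambda ^+ (2 * a.+1) * (1 + (beta * c ^+ (2 * a.+1))^-1) < 1 ->
  (lambda%:E <= stab_radius (matrix_pair theta c beta))%E.
Proof.
move=> c0 beta1 l0 hr; rewrite leNgt; apply/negP => hlt.
(* Restricting the constant [M] to positive integers makes the union countable; if the radius were
   below [lambda], these null sets would cover the unit interval. *)
pose S (n : nat) := [set t : measurableTypeR R | exists A : nat -> 'M[R]_2,
    (forall k, matrix_pair theta c beta (A k)) /\
    (forall k, `|trajectory A (affine_point t) k| <= n.+1%:R * lambda ^+ k)].
have neg : (@lebesgue_measure R).-negligible `[0, 1]%classic.
  apply: (@negligibleS _ _ _ _ (\bigcup_n S n)); last first.
    apply: negligible_bigcup => n.
    exact: (negligible_bounded_rate theta c0 beta1 l0 (ltr0Sn R n) hr).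
  move=> t /=; rewrite in_itv/= => t01.
  have : (stab_radius_at (matrix_pair theta c beta) (affine_point t) < lambda%:E)%E.
    apply: le_lt_trans hlt; apply: ereal_sup_ubound.
    exists (affine_point t) => //= /(congr1 (fun v : 'cV[R]_2 => v ord0 ord0)).
    by rewrite !mxE/= => /eqP; rewrite oner_eq0.
  case/ereal_inf_lt => _ [m [m0 [M [M0 [A [hA ht]]]]] <-]; rewrite lte_fin => ml.
  exists (Num.bound M) => //; exists A; split => // k.
  rewrite (le_trans (ht k))// norm_affine_point// mulr1.
  apply: ler_pM => //; [exact: ltW|exact: exprn_ge0| |].
    by rewrite ltW// (lt_le_trans (archi_boundP (ltW M0)))// ler_nat.
  by rewrite lerXn2r ?nnegrE// ltW.
have : lebesgue_measure (`[0, 1]%classic : set R) = 0%E.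
  by apply: measure_negligible neg; exact: measurable_itv.
rewrite lebesgue_measure_itv/= lte_fin ltr01 sube0 => /eqP.
by rewrite eqe oner_eq0.
Qed.

(** * Choice of [c] and passage to the limit *)

Lemma dbar_ge0 (R : realType) (J : option int) (beta : R) : (0 <= dbar J beta)%E.
Proof.
apply: le_ereal_sup_tmp; exists (dbar_at J beta 1); first by exists 1 => /=.
apply: le_ereal_inf_tmp => _ [d _ <-]; apply: limf_esup_ge0.
  exact: filter_not_empty.
move=> k; rewrite lee_fin mulr_ge0 ?invr_ge0//.
by apply: fsumr_ge0.
Qed.

(* The value of [c ^+ (2 * a.+1)] is chosen so that [stab_radius_ge] applies to
   every [lambda] below [c `^ (Finv beta + 1)^-1]; the exponent is taken large
   enough to fulfil the constraint [c^-1 <= Num.sqrt beta]. *)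
Lemma exists_contraction (R : realType) (beta : R) : 1 < beta ->
  exists (a : nat) (c : R), [/\ 0 < c, 1 < c^-1, c^-1 <= Num.sqrt beta &
    forall lambda, 0 < lambda -> lambda < c `^ (Finv beta + 1)^-1 ->
    lambda ^+ (2 * a.+1) * (1 + (beta * c ^+ (2 * a.+1))^-1) < 1].
Proof.
move=> b1; set x := Finv beta.
have b0 : 0 < beta by lra.
have x0 : 0 < x by exact: Finv_gt0.
have Fx : F x = beta by exact: FinvK.
have xb : x < beta by have := @add1_le_F R x (ltW x0); rewrite Fx; lra.
have lb0 : 0 < ln beta by rewrite ln_gt0.
pose y := beta / x.
have y1 : 1 < y by rewrite ltr_pdivlMr// mul1r.
have y0 : 0 < y by rewrite (lt_trans _ y1).
have ly0 : 0 < ln y by rewrite ln_gt0.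
(* This gives [ln y <= a * ln beta], hence [u <= ln beta / 2], which is the constraint on [c^-1]. *)
pose a := Num.bound (ln y / ln beta).
have ha : ln y < a%:R * ln beta.
  by rewrite -ltr_pdivrMr// archi_boundP// divr_ge0// ltW.
pose N : R := (2 * a.+1)%:R.
have N0 : 0 < N by rewrite ltr0n.
pose u := ln y / N.
have u0 : 0 < u by rewrite divr_gt0.
pose c := expR (- u).
have cN : c ^+ (2 * a.+1) = y^-1.
  by rewrite /c -expRM_natl mulrN mulrC divfK ?gt_eqF// expRN lnK.
exists a, c; split; first exact: expR_gt0.
- by rewrite /c expRN invrK expR_gt1.
- have -> : Num.sqrt beta = expR (ln beta / 2).
    rewrite -{1}[beta]lnK ?posrE// {1}(splitr (ln beta)) expRD -expr2 sqrtr_sqr.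
    by rewrite gtr0_norm// expR_gt0.
  rewrite /c expRN invrK ler_expR /u ler_pdivrMr// /N natrM mulrA divfK ?pnatr_eq0//.
  by apply: le_trans (ltW ha) _; rewrite mulrC ler_wpM2l ?ler_nat// ltW.
move=> lambda l0 hl.
rewrite cN; have -> : (beta * y^-1)^-1 = x^-1 by rewrite /y; field; rewrite !gt_eqF.
have x1 : 0 < 1 + x^-1 by rewrite addr_gt0// invr_gt0.
rewrite -ltr_pdivlMr// mul1r.
apply: (@lt_le_trans _ _ ((c `^ (x + 1)^-1) ^+ (2 * a.+1))).
  by rewrite ltrXn2r// ?nnegrE ltW.
rewrite -powR_mulrn ?powR_ge0// -powRrM mulrC powRrM powR_mulrn ?expR_ge0//.
rewrite cN /powR gt_eqF ?invr_gt0//.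
rewrite -[leRHS]lnK ?posrE ?invr_gt0// ler_expR !lnV ?posrE//.
rewrite mulrN lerN2 mulrC ler_pdivlMr ?addr_gt0//.
(* From [beta = F x] one gets [beta / x = (1 + 1 / x)]^ (x + 1)[, so the criterion is critical
   exactly at]c [^ (x + 1)^-1]. *)
have -> : ln y = (x + 1) * ln (1 + x^-1).
  by rewrite /y ln_div ?posrE// -[in ln beta]Fx F_inv// expRK lnV ?posrE// opprK addrK.
by rewrite mulrC.
Qed.

Theorem theorem3 (R : realType) (J : option int) :
  [/\ {in `[0, +oo[ &, {homo @F R : x y / x < y}},
      @F R @` `[0, +oo[%classic = `[1, +oo[%classic &
      (forall c beta : R, c^-1 <= Num.sqrt beta -> 1 < c^-1 ->
         stab_radius (matrix_pair theta c beta) @[theta --> 0^'] -->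
           (c `^ fine (dbar J beta + 1)^-1%E)%:E) ->
      forall beta : R, 1 < beta -> ((Finv beta)%:E <= dbar J beta)%E].
Proof.
split; [exact: F_lt|exact: F_image|move=> conj beta b1].
have [a [c [c0 c1 cb hc]]] := exists_contraction b1.
have := conj c beta cb c1; have := dbar_ge0 J beta.
case: (dbar J beta) => [d| |]; [|by rewrite !leey|by rewrite leeNy_eq].
rewrite !lee_fin => d0; rewrite -EFinD /= /inve/= gt_eqF; last by lra.
rewrite /= leNgt => lim; apply/negP => dx.
set L := c `^ (d + 1)^-1 in lim; set L0 := c `^ (Finv beta + 1)^-1 in hc.
have LL0 : L < L0.
  rewrite /L /L0 /powR gt_eqF// ltr_expR ltr_nM2r; last first.
    by apply: ln_lt0; rewrite c0/= -invf_gt1.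
  by rewrite ltf_pV2 ?posrE; lra.
have L1 : 0 < L by exact: powR_gt0.
(* As [c < 1], a too small [d] puts the limit [L] below [L0]. Near 0 the radius then drops below
   this midpoint, against the uniform lower bound. *)
pose lambda := (L + L0) / 2.
have l0 : 0 < lambda by rewrite /lambda; lra.
have lL : L < lambda by rewrite /lambda; lra.
have lL0 : lambda < L0 by rewrite /lambda; lra.
have hlim : \forall theta \near 0^',
    (stab_radius (matrix_pair theta c beta) < lambda%:E)%E.
  apply: (lim [set z | (z < lambda%:E)%E]).
  apply: open_nbhs_nbhs; split; first exact: open_ereal_lt_ereal.
  by rewrite /= lte_fin.
have [theta] := @filter_ex _ (0 : R)^' _ _ hlim.
by rewrite ltNge (stab_radius_ge theta c0 (ltW b1) l0 (hc _ l0 lL0)).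
Qed.
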